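(* Write the Knizhnik–Zamolodchikov system in the variables $u=(u_1,\dots,u_n)$ as $$\frac{\partial W}{\partial u_j}=\rho H_j(u)W,\qquad 1\le j\le n.$$ Then the matrix function $H_1$ depends only on $u_1$ and has the form $$H_1=\frac{1}{u_1}\sum_{k>j}P_{k,j},$$ where the sum is over all pairs $1\le j<k\le n$.
   Context: The Knizhnik–Zamolodchikov system is $\frac{\partial W}{\partial z_j}=\rho A_jW$, $1\le j\le n$, with $A_j=\sum_{k\ne j}\frac{P_{j,k}}{z_j-z_k}$ and $z_k\ne z_\ell$ for $k\neq\ell$; $\rho$ is arbitrary (not necessarily an integer). For $i\ne j$, $P_{i,j}=P_{j,i}$ is the $n\times n$ permutation matrix of the transposition $(i;j)$: its $(i,j)$ and $(j,i)$ entries are $1$, its $(k,k)$ entries are $1$ for $k\ne i,j$, and all other entries are $0$. The new variables are $$u_1=z_1-z_2,\quad u_k=\frac{z_k-z_{k+1}}{z_{k-1}-z_k}\ (2\le k\le n-1),\quad u_n=z_1+z_2+\dots+z_n,$$ and by the chain rule $H_j(u)=\sum_{k=1}^n\frac{\partial z_k}{\partial u_j}A_k$, expressed in the variables $u$. *)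

(* Defs.v *)
From HB Require Import structures.
From mathcomp Require Export all_boot all_order all_algebra.
From mathcomp Require Export perm.
From mathcomp Require Export boolp classical_sets functions.
From mathcomp Require Export topology normedtype derive.

Set Implicit Arguments.
Unset Strict Implicit.
Unset Printing Implicit Defensive.

Import Order.TTheory GRing.Theory Num.Theory.
Import numFieldNormedType.Exports.

Local Open Scope classical_set_scope.
Local Open Scope ring_scope.

(* The number of variables is n.+2, i.e. an arbitrary integer >= 2, and indices
   are shifted by one: z_1, ..., z_{n+2} are z 0 ord0, ..., z 0 ord_max.
   K is any field with an absolute value in the sense of numFieldType; this
   covers both the real and the complex numbers. *)

Definition kz_domain (K : numFieldType) (n : nat) : set 'rV[K]_n.+2 :=
  [set z | forall k l, k != l -> z 0 k != z 0 l].

Definition kz_A (K : numFieldType) (n : nat) (j : 'I_n.+2) (z : 'rV[K]_n.+2) :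
    'M[K]_n.+2 :=
  \sum_(k | k != j) (z 0 j - z 0 k)^-1 *: tperm_mx j k.

Definition u_of_z (K : numFieldType) (n : nat) (z : 'rV[K]_n.+2) :
    'rV[K]_n.+2 :=
  \row_k
    if k == ord_max then \sum_i z 0 i
    else if k == ord0 then z 0 k - z 0 (inord k.+1)
    else (z 0 k - z 0 (inord k.+1)) / (z 0 (inord k.-1) - z 0 k).

Definition u_domain (K : numFieldType) (n : nat) : set 'rV[K]_n.+2 :=
  @u_of_z K n @` @kz_domain K n.

(* The inverse of the change of variables z |-> u on kz_domain, where that map
   is injective; the value 0 outside u_domain is irrelevant, since u_domain is
   open. *)
Definition z_of_u (K : numFieldType) (n : nat) : 'rV[K]_n.+2 -> 'rV[K]_n.+2 :=
  'pinv_(fun=> 0) (@kz_domain K n) (@u_of_z K n).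

Definition kz_H (K : numFieldType) (n : nat) (j : 'I_n.+2) (u : 'rV[K]_n.+2) :
    'M[K]_n.+2 :=
  \sum_k 'D_(delta_mx 0 j) (fun v : 'rV[K]_n.+2 => z_of_u v 0 k) u
           *: kz_A k (z_of_u u).

(* W solves dW/dx_j = B_j(x) W, for all j, on D. The number m of columns of W
   is arbitrary: m = 1 gives vector solutions, m = n matrix solutions. *)
Definition solves_system (K : numFieldType) (n m : nat) (D : set 'rV[K]_n)
    (B : 'I_n -> 'rV[K]_n -> 'M[K]_n) (W : 'rV[K]_n -> 'M[K]_(n, m)) : Prop :=
  forall x, D x ->
    differentiable W x /\
    forall j, 'D_(delta_mx 0 j) W x = B j x *m W x.

(* Main.v *)
From HB Require Import structures.
From mathcomp Require Import landau ring.
Require Import Defs.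

(* The differences z_k - z_(k+1) are the products u_1 ... u_k, so the inverse of
   z |-> u is polynomial; hence both changes of variables are differentiable and
   the chain rule carries the system back and forth. With c the mean of the z_k,
   each z_k - c is homogeneous of degree one in u_1, while c = u_n / n does not
   involve it; so dz_k/du_1 = (z_k - c) / u_1, and in sum_k (z_k - c) A_k the two
   terms carrying P_(j,k) add up to P_(j,k). *)

Set Implicit Arguments.
Unset Strict Implicit.
Unset Printing Implicit Defensive.

Import Order.TTheory GRing.Theory Num.Theory.
Import numFieldNormedType.Exports.

Local Open Scope classical_set_scope.
Local Open Scope ring_scope.

(** * Local tools for differentiability and directional derivatives *)

Lemma near_eq_differentiable (K : numFieldType) (V W : normedModType K)
    (f g : V -> W) (x : V) :
  (\near x, f x = g x) -> differentiable f x -> differentiable g x.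
Proof.
move=> fg df; have fgx := nbhs_singleton fg.
have dfc := diff_continuous df.
(* The first-order expansion depends only on the germ at [x], so ['d f x] also serves as the
   differential of [g]; [diff_unique] identifies the two. *)
suff h : g \o shift x = cst (g x) + 'd f x +o_ 0 id.
  by apply/diff_locallyP; rewrite (diff_unique dfc h).
have /eqaddoP hf := diff_locally df.
apply/eqaddoP => e e0; near=> y.
have -> : (g \o shift x - (cst (g x) + 'd f x)) y =
          (f \o shift x - (cst (f x) + 'd f x)) y.
  rewrite !fctE/= fgx; congr (_ - _); symmetry.
  near: y; move: fg; rewrite (near_shift 0).
  by apply: filterS => y /=; rewrite subr0.
by near: y; exact: hf.
Unshelve. all: by end_near. Qed.

(** The difference quotient equals [c] for every nonzero [h], so no limit has to be computed. *)
Lemma derive_affine (K : numFieldType) (V W : normedModType K) (f : V -> W)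
    (x v : V) (c : W) :
  (forall h : K, f (h *: v + x) = f x + h *: c) -> 'D_v f x = c.
Proof.
move=> fE; rewrite /derive; apply: lim_near_cst => //.
have /= nz := @nbhs_dnbhs_neq K 0.
near=> h; rewrite /= fE addrC addKr scalerA mulVf ?scale1r//.
by near: h.
Unshelve. all: by end_near. Qed.

(** * Linear differential systems under a change of variables *)

Section row_functions.
Variables (K : numFieldType) (n : nat).

Lemma derive_coord (V : normedModType K) (f : V -> 'rV[K]_n) (k : 'I_n)
    (x v : V) :
  differentiable f x -> 'D_v (fun y => f y 0 k) x = ('D_v f x) 0 k.
Proof.
move=> df.
have lin : linear (fun N : 'rV[K]_n => N 0 k) by move=> c A B; rewrite !mxE.
pose lM := GRing.isLinear.Build _ _ _ _ _ lin.
(* The coordinate projection is bundled as a linear map; being continuous, it is its own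
   differential. *)
have [l lE] : exists l : {linear 'rV[K]_n -> K},
    (fun N : 'rV[K]_n => N 0 k) = l :> (_ -> K).
  pose l : {linear 'rV[K]_n -> K} := HB.pack (fun N : 'rV[K]_n => N 0 k) lM.
  by exists l.
have lc : continuous l by rewrite -lE; exact: coord_continuous.
have dl : differentiable l (f x) by exact: linear_differentiable.
rewrite -[_ 0 k]/((fun N : 'rV[K]_n => N 0 k) _) lE.
have -> : (fun y => f y 0 k) = l \o f by rewrite -lE.
rewrite !deriveE//; last exact: differentiable_comp.
by rewrite diff_comp//= diff_lin.
Qed.

Lemma differentiable_row (V : normedModType K) (f : V -> 'rV[K]_n) (x : V) :
  (forall k, differentiable (fun y => f y 0 k) x) -> differentiable f x.
Proof.
move=> df.
have -> : f = \sum_k (fun y => f y 0 k *: delta_mx 0 k).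
  by apply/funext => y; rewrite {1}[f y]row_sum_delta fct_sumE.
by apply: differentiable_sum => k; exact: differentiableZl.
Qed.

(** Chain-rule coefficients of the system that [W \o g] satisfies when [W] solves the one given by
    [B]. Keeping [g] arbitrary lets pullbacks be composed and covers both directions of the change
    of variables. *)
Definition pullback (g : 'rV[K]_n -> 'rV[K]_n) (B : 'I_n -> 'rV[K]_n -> 'M[K]_n)
    (j : 'I_n) (x : 'rV[K]_n) : 'M[K]_n :=
  \sum_k 'D_(delta_mx 0 j) (fun y => g y 0 k) x *: B k (g x).

Lemma pullback_near_id (h : 'rV[K]_n -> 'rV[K]_n) B j x :
  (\near x, h x = x) -> pullback h B j x = B j x.
Proof.
move=> hid; have hx := nbhs_singleton hid.
have hD k : 'D_(delta_mx 0 j) (fun y => h y 0 k) x = (j == k)%:R.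
  rewrite (@near_eq_derive _ _ _ _ (fun y : 'rV[K]_n => y 0 k)); last first.
    by apply: filterS hid => y ->.
  by rewrite derive_coord// derive_id mxE eqxx eq_sym.
rewrite /pullback hx (bigD1 j)//= hD eqxx scale1r big1 ?addr0// => k /negPf kj.
by rewrite hD eq_sym kj scale0r.
Qed.

Lemma derive_comp_row (W : normedModType K) (f : 'rV[K]_n -> W)
    (g : 'rV[K]_n -> 'rV[K]_n) x v :
  differentiable g x -> differentiable f (g x) ->
  'D_v (f \o g) x =
    \sum_k 'D_v (fun y => g y 0 k) x *: 'D_(delta_mx 0 k) f (g x).
Proof.
move=> dg df; rewrite deriveE; last exact: differentiable_comp.
rewrite diff_comp//= -(deriveE v dg) [X in 'd f (g x) X]row_sum_delta linear_sum.
by apply: eq_bigr => k _; rewrite linearZ/= derive_coord// -(deriveE _ df).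
Qed.

(** Functoriality of the pullback: after exchanging the two sums, the coefficient of each [B k] is
    the chain rule for the [k]-th coordinate of [g \o f]. *)
Lemma pullback_comp (f g : 'rV[K]_n -> 'rV[K]_n) B j x :
  differentiable f x -> differentiable g (f x) ->
  pullback f (pullback g B) j x = pullback (g \o f) B j x.
Proof.
move=> df dg; rewrite /pullback.
under eq_bigr do rewrite scaler_sumr.
rewrite exchange_big; apply: eq_bigr => k _ /=.
have dgk : differentiable (fun y => g y 0 k) (f x).
  exact: (differentiable_comp dg (differentiable_coord _ _ _)).
rewrite (derive_comp_row _ df dgk) scaler_suml.
by apply: eq_bigr => l _; rewrite scalerA.
Qed.

Lemma solves_system_pullback (m : nat) (D E : set 'rV[K]_n) B
    (W : 'rV[K]_n -> 'M[K]_(n, m)) (g : 'rV[K]_n -> 'rV[K]_n) :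
  (forall x, E x -> D (g x)) -> (forall x, E x -> differentiable g x) ->
  solves_system D B W -> solves_system E (pullback g B) (W \o g).
Proof.
move=> gD dg sW x Ex; have [dW DW] := sW _ (gD _ Ex).
split=> [|j]; first exact: (differentiable_comp (dg _ Ex)).
rewrite derive_comp_row//; last exact: dg.
rewrite mulmx_suml; apply: eq_bigr => k _.
by rewrite DW -scalemxAl.
Qed.

(** Openness of [D] turns equality on [D] into equality near each point, which is what derivatives
    see. *)
Lemma eq_solves_system (m : nat) (D : set 'rV[K]_n) B C
    (V W : 'rV[K]_n -> 'M[K]_(n, m)) :
  open D -> (forall j x, D x -> B j x = C j x) ->
  (forall x, D x -> V x = W x) ->
  solves_system D B V -> solves_system D C W.
Proof.
move=> oD BC VW sV x Dx; have [dV DV] := sV _ Dx.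
have VWx : \near x, V x = W x.
  by apply: filterS VW _; exact: open_nbhs_nbhs.
split=> [|j]; first exact: near_eq_differentiable dV.
by rewrite -(near_eq_derive _ VWx) DV BC// VW.
Qed.

Lemma solves_system_change_var (m : nat) (D E : set 'rV[K]_n)
    (f g : 'rV[K]_n -> 'rV[K]_n) B (W : 'rV[K]_n -> 'M[K]_(n, m)) :
  open D ->
  (forall x, D x -> E (f x)) -> (forall x, E x -> D (g x)) ->
  (forall x, D x -> differentiable f x) ->
  (forall x, E x -> differentiable g x) ->
  {in D, cancel f g} ->
  solves_system D B W <-> solves_system E (pullback g B) (W \o g).
Proof.
move=> oD fE gD df dg fK; split; first exact: solves_system_pullback.
(* For the converse, pulling back along [f] as well gives the pullback along [g \o f], which is the
   identity near each point of [D]. *)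
move=> /(solves_system_pullback fE df); apply: eq_solves_system => //.
  move=> j x Dx; rewrite pullback_comp; [|exact: df|exact/dg/fE].
  apply: pullback_near_id.
  apply: (@filterS _ (nbhs x) _ D); last exact: open_nbhs_nbhs.
  by move=> y Dy /=; apply/fK/mem_set.
by move=> x Dx /=; rewrite fK//; exact/mem_set.
Qed.

End row_functions.

(** * The domain in the variables z and the map to the variables u *)

Lemma kz_domain_open (K : numFieldType) n : open (@kz_domain K n).
Proof.
rewrite openE => z zD.
suff: nbhs z (fun y : 'rV[K]_n.+2 => forall k l, k != l -> y 0 k != y 0 l).
  by [].
apply: (@filter_forall _ _ (fun k (y : 'rV[K]_n.+2) =>
  forall l, k != l -> y 0 k != y 0 l) (nbhs z)) => k.
apply: (@filter_forall _ _ (fun l (y : 'rV[K]_n.+2) =>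
  k != l -> y 0 k != y 0 l) (nbhs z)) => l.
have [<-|kl] := eqVneq k l; first by apply: nearW => y; rewrite eqxx.
apply: (@filterS _ (nbhs z) _ (fun y : 'rV[K]_n.+2 => y 0 k - y 0 l != 0)).
  by move=> y /= ykl _; rewrite -subr_eq0.
have c : {for z, continuous (fun y : 'rV[K]_n.+2 => y 0 k - y 0 l)}.
  apply: differentiable_continuous.
  by apply: differentiableB; exact: differentiable_coord.
by apply: (cvgr_neq0 _ c); rewrite subr_eq0; exact: zD.
Qed.

Lemma differentiable_u_of_z (K : numFieldType) n (z : 'rV[K]_n.+2) :
  kz_domain z -> differentiable (@u_of_z K n) z.
Proof.
move=> zD; apply: differentiable_row => k.
have dB i j : differentiable (fun y : 'rV[K]_n.+2 => y 0 i - y 0 j) z.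
  by apply: differentiableB; exact: differentiable_coord.
under eq_fun do rewrite mxE.
have [_|kmax] := eqVneq k ord_max.
  rewrite -fct_sumE; apply: differentiable_sum => i; exact: differentiable_coord.
have [_|k0] := eqVneq k ord0; first exact: dB.
apply: differentiableM => //; apply: differentiableV => //.
(* The denominator is a difference of two distinct coordinates: since [k] is nonzero, the truncated
   predecessor [k.-1] differs from [k]. *)
rewrite subr_eq0; apply: zD; apply/eqP => /(congr1 val) /=.
have k_gt0 : (0 < k)%N by rewrite lt0n.
by rewrite inordK ?(leq_ltn_trans (leq_pred _))// => /eqP; rewrite ltn_eqF// prednK.
Qed.

(* [gap u i] is u_1 ... u_(i+1) = z_(i+1) - z_(i+2) in the paper's indexing. *)
Fixpoint gap (K : numFieldType) n (u : 'rV[K]_n.+2) (i : nat) : K :=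
  u 0 (inord i) * (if i is i'.+1 then gap u i' else 1).

(* z_(k+1) minus the mean of the z_i, in terms of u. *)
Definition deviation (K : numFieldType) n (u : 'rV[K]_n.+2) (k : nat) : K :=
  n.+2%:R^-1 * (\sum_(l < n.+2) \sum_(i < l) gap u i) - \sum_(i < k) gap u i.

Definition poly_z_of_u (K : numFieldType) n (u : 'rV[K]_n.+2) : 'rV[K]_n.+2 :=
  \row_k (n.+2%:R^-1 * u 0 ord_max + deviation u k).

(** * The polynomial inverse of the change of variables *)

Section change_of_variables.
Variables (K : numFieldType) (n : nat).
Implicit Types u z : 'rV[K]_n.+2.

Lemma differentiable_poly_z_of_u u : differentiable (@poly_z_of_u K n) u.
Proof.
have dgap i : differentiable ((@gap K n)^~ i) u.
  elim: i => [|i IH] /=; apply: differentiableM => //;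
    exact: differentiable_coord.
have dsum (k : nat) : differentiable (fun v => \sum_(i < k) gap v i) u.
  by rewrite -fct_sumE; apply: differentiable_sum.
apply: differentiable_row => k; rewrite /poly_z_of_u /deviation.
under eq_fun do rewrite mxE.
apply: differentiableD.
  exact/differentiableZ/differentiable_coord.
apply: differentiableB => //; apply: differentiableZ.
by rewrite -fct_sumE; apply: differentiable_sum.
Qed.

(** The product telescopes: the denominator of each ratio is the previous gap, nonzero on the
    domain. *)
Lemma gap_u_of_z z i : kz_domain z -> (i < n.+1)%N ->
  gap (u_of_z z) i = z 0 (inord i) - z 0 (inord i.+1).
Proof.
move=> zD; elim: i => [|i IH] lin.
  rewrite /= mulr1 mxE -val_eqE /= inordK// ltn_eqF//=.
  by rewrite -val_eqE /= inordK.
rewrite /= IH ?(ltnW lin)// mxE -!val_eqE /= inordK; last exact: ltnW.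
rewrite ltn_eqF//= divfK// subr_eq0; apply: zD.
by rewrite -val_eqE /= !inordK ?ltn_eqF// ltnW// ltnW.
Qed.

Lemma sum_gap_u_of_z z (k : nat) : kz_domain z -> (k < n.+2)%N ->
  \sum_(i < k) gap (u_of_z z) i = z 0 ord0 - z 0 (inord k).
Proof.
move=> zD; elim: k => [|k IH] kn.
  by rewrite big_ord0 (_ : inord 0 = ord0) ?subrr//; apply/val_inj; rewrite /= inordK.
by rewrite big_ord_recr/= IH ?(ltnW kn)// gap_u_of_z// addrA subrK.
Qed.

Lemma u_of_zK z : kz_domain z -> poly_z_of_u (u_of_z z) = z.
Proof.
move=> zD; apply/rowP => k; rewrite mxE /deviation sum_gap_u_of_z// inord_val.
under eq_bigr do rewrite sum_gap_u_of_z// inord_val.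
(* The mean of [z 0 ord0 - z 0 l] over [l] is [z 0 ord0] minus the mean of the coordinates; adding
   back that mean and subtracting [z 0 ord0 - z 0 k] leaves [z 0 k]. *)
rewrite sumrB sumr_const card_ord mxE eqxx -[z 0 ord0 *+ _]mulr_natr.
rewrite mulrBr [z 0 ord0 * _]mulrC mulKf ?pnatr_eq0//.
by ring.
Qed.

Lemma poly_z_of_u_sub u (k : nat) : (k < n.+1)%N ->
  poly_z_of_u u 0 (inord k) - poly_z_of_u u 0 (inord k.+1) = gap u k.
Proof.
move=> kn; rewrite !mxE /deviation !inordK//; last exact: ltnW.
by rewrite [\sum_(i < k.+1) _]big_ord_recr/=; ring.
Qed.

(** The deviations from the mean add up to zero. *)
Lemma sum_poly_z_of_u u : \sum_i poly_z_of_u u 0 i = u 0 ord_max.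
Proof.
have n0 : n.+2%:R != 0 :> K by rewrite pnatr_eq0.
under eq_bigr do rewrite mxE /deviation.
rewrite big_split/= sumrB !sumr_const card_ord -2!(mulr_natl (_^-1 * _)).
by rewrite !mulVKf// subrr addr0.
Qed.

Lemma poly_z_of_uK u : kz_domain (poly_z_of_u u) -> u_of_z (poly_z_of_u u) = u.
Proof.
move=> zD; apply/rowP => k; rewrite mxE.
have [->|kmax] := eqVneq k ord_max; first exact: sum_poly_z_of_u.
have kn : (k < n.+1)%N.
  by rewrite ltn_neqAle -ltnS ltn_ord andbT; exact: kmax.
have -> : poly_z_of_u u 0 k = poly_z_of_u u 0 (inord k) by rewrite inord_val.
rewrite poly_z_of_u_sub//; have [->|k0] := eqVneq k ord0.
  by rewrite /= mulr1; congr (u _ _); apply/val_inj; rewrite /= inordK.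
(* A middle coordinate is the quotient of the gaps at [k] and [k.-1], the latter nonzero because the
   values of [z] are distinct. *)
have kE : k = k.-1.+1 :> nat by rewrite prednK// lt0n.
have kn' : (k.-1 < n.+1)%N by rewrite (leq_ltn_trans (leq_pred _)).
have -> : (inord k : 'I_n.+2) = inord k.-1.+1 by rewrite -kE.
rewrite (poly_z_of_u_sub _ kn') {1}kE /= -kE inord_val mulfK//.
rewrite -(poly_z_of_u_sub _ kn') subr_eq0; apply: zD.
by rewrite -val_eqE/= !inordK ?ltn_eqF// ltnW.
Qed.

Lemma u_domainE u : u_domain u <-> kz_domain (poly_z_of_u u).
Proof.
split=> [[z zD <-]|zD]; first by rewrite u_of_zK.
by exists (poly_z_of_u u) => //; exact: poly_z_of_uK.
Qed.

(** The left inverse [poly_z_of_u] makes [u_of_z] injective on [kz_domain], so the chosen inverse is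
    the true one there. *)
Lemma z_of_uE u : u_domain u -> z_of_u u = poly_z_of_u u.
Proof.
move=> [z zD <-]; rewrite u_of_zK// /z_of_u pinvKV//; last exact: mem_set.
by move=> x y /set_mem xD /set_mem yD xy; rewrite -(u_of_zK xD) xy u_of_zK.
Qed.

(** A preimage of an open set under a polynomial map. Openness is what allows [z_of_u] to be
    replaced by the polynomial inside derivatives. *)
Lemma u_domain_open : open (@u_domain K n).
Proof.
have -> : @u_domain K n = @poly_z_of_u K n @^-1` @kz_domain K n.
  by apply/seteqP; split=> u /u_domainE.
apply: open_comp; last exact: kz_domain_open.
by move=> u _; apply/differentiable_continuous/differentiable_poly_z_of_u.
Qed.

Lemma near_z_of_u u : u_domain u -> \near u, z_of_u u = poly_z_of_u u.
Proof.
move=> uD; apply: (filterS z_of_uE).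
by apply: open_nbhs_nbhs; split=> //; exact: u_domain_open.
Qed.

Lemma kz_HE j u : u_domain u ->
  kz_H j u = pullback (@poly_z_of_u K n) (@kz_A K n) j u.
Proof.
move=> uD; rewrite /kz_H /pullback z_of_uE//; apply: eq_bigr => k _.
congr (_ *: _); apply: near_eq_derive.
by apply: filterS (near_z_of_u uD) => v ->.
Qed.

(** * The derivative in the first variable and the formula for the first matrix *)

Lemma u0_neq0 u : u_domain u -> u 0 ord0 != 0.
Proof.
move=> [z zD <-]; rewrite mxE /= subr_eq0; apply: zD.
by rewrite -val_eqE /= inordK.
Qed.

(** Each of these gaps contains the factor [u 0 ord0] exactly once, so adding [h] to that factor
    rescales the whole product. *)
Lemma gap_scale u h i : u 0 ord0 != 0 -> (i < n.+1)%N ->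
  gap (h *: delta_mx 0 ord0 + u) i = (1 + h / u 0 ord0) * gap u i.
Proof.
move=> u0; elim: i => [|i IH] lin.
  rewrite /= !mxE (_ : inord 0 = ord0); last by apply/val_inj; rewrite /= inordK.
  by rewrite !eqxx /= !mulr1 mulrDl mul1r divfK// addrC.
rewrite /= IH ?(ltnW lin)// !mxE eqxx -val_eqE /= inordK ?(leqW lin)//=.
by rewrite mulr0 add0r mulrCA.
Qed.

Lemma deviation_scale u h (k : 'I_n.+2) : u 0 ord0 != 0 ->
  deviation (h *: delta_mx 0 ord0 + u) k = (1 + h / u 0 ord0) * deviation u k.
Proof.
move=> u0; have sE (l : 'I_n.+2) :
    \sum_(i < l) gap (h *: delta_mx 0 ord0 + u) i =
    (1 + h / u 0 ord0) * \sum_(i < l) gap u i.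
  rewrite mulr_sumr; apply: eq_bigr => i _; apply: gap_scale => //.
  by rewrite (leq_trans (ltn_ord i))// -ltnS.
rewrite /deviation sE; under eq_bigr do rewrite sE.
by rewrite -mulr_sumr mulrCA mulrBr.
Qed.

(** Along the first coordinate the map is affine: the deviation scales, and the mean stays fixed
    because [ord_max] differs from [ord0]. *)
Lemma derive_poly_z_of_u0 u (k : 'I_n.+2) : u 0 ord0 != 0 ->
  'D_(delta_mx 0 ord0) (fun v => poly_z_of_u v 0 k) u =
  (u 0 ord0)^-1 * deviation u k.
Proof.
move=> u0; apply: derive_affine => h.
rewrite mxE [in RHS]mxE deviation_scale// !mxE eqxx -val_eqE /= mulr0 add0r.
by rewrite /GRing.scale/=; ring.
Qed.

Lemma sum_kz_A z (c : K) : kz_domain z ->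
  \sum_k (z 0 k - c) *: kz_A k z =
  \sum_(j < n.+2) \sum_(k < n.+2 | (j < k)%N) tperm_mx k j.
Proof.
move=> zD.
pose F k j : 'M[K]_n.+2 := ((z 0 k - c) / (z 0 k - z 0 j)) *: tperm_mx k j.
(* The ordered pairs are split by which index is larger; exchanging the sums in one half brings the
   two terms of each transposition together. *)
transitivity (\sum_(k < n.+2) (\sum_(j < n.+2 | (j < k)%N) F k j +
    \sum_(j < n.+2 | (k < j)%N) F k j)).
  apply: eq_bigr => k _; rewrite /kz_A scaler_sumr.
  under eq_bigr do rewrite scalerA.
  rewrite (bigID (fun j : 'I_n.+2 => (j < k)%N))/=; congr (_ + _);
    by apply: eq_bigl => j; rewrite -val_eqE/=; case: ltngtP.
rewrite big_split/= [X in X + _](exchange_big_dep predT)//=.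
rewrite -big_split; apply: eq_bigr => j _ /=; rewrite -big_split/=.
apply: eq_bigr => k jk; rewrite /F.
have -> : tperm_mx j k = tperm_mx k j :> 'M[K]_n.+2.
  by rewrite /tperm_mx tpermC.
have zkj : z 0 k - z 0 j != 0.
  by rewrite subr_eq0; apply: zD; rewrite -val_eqE/= gtn_eqF.
(* The constant [c] cancels: the two numerators combine to [z 0 k - z 0 j], which is the common
   denominator. *)
rewrite -scalerDl -[z 0 j - z 0 k]opprB invrN mulrN -mulrBl.
by rewrite opprB addrA subrK divff// scale1r.
Qed.

Lemma kz_H0E u : u_domain u ->
  kz_H ord0 u =
    (u 0 ord0)^-1 *: \sum_(j < n.+2) \sum_(k < n.+2 | (j < k)%N) tperm_mx k j.
Proof.
move=> uD; have zD := (u_domainE u).1 uD.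
(* Choosing [c] as the mean of the coordinates makes [z 0 k - c] the deviation that appears in the
   derivative. *)
rewrite kz_HE// /pullback -(sum_kz_A (n.+2%:R^-1 * u 0 ord_max) zD) scaler_sumr.
apply: eq_bigr => k _; rewrite derive_poly_z_of_u0 ?u0_neq0// scalerA.
by congr (_ * _ *: _); rewrite [in RHS]mxE addrC addKr.
Qed.

End change_of_variables.

(* First conjunct: the Knizhnik-Zamolodchikov system, written in the variables
   u, is dW/du_j = rho H_j(u) W. *)
Theorem proposition4p2 (K : numFieldType) (n m : nat) (rho : K) :
  (forall W : 'rV[K]_n.+2 -> 'M[K]_(n.+2, m),
     solves_system (@kz_domain K n) (fun j z => rho *: kz_A j z) W <->
     solves_system (@u_domain K n) (fun j u => rho *: kz_H j u)
       (W \o @z_of_u K n)) /\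
  (forall u v : 'rV[K]_n.+2, u_domain u -> u_domain v ->
     u 0 ord0 = v 0 ord0 -> kz_H ord0 u = kz_H ord0 v) /\
  (forall u : 'rV[K]_n.+2, u_domain u ->
     kz_H ord0 u =
       (u 0 ord0)^-1 *: \sum_(j < n.+2) \sum_(k < n.+2 | (j < k)%N) tperm_mx k j).
Proof.
split=> [W|]; last first.
  split=> [u v uD vD uv|u]; last exact: kz_H0E.
  by rewrite !kz_H0E// uv.
have HE j u : u_domain u ->
    rho *: kz_H j u =
    pullback (@poly_z_of_u K n) (fun j z => rho *: kz_A j z) j u.
  move=> uD; rewrite kz_HE// scaler_sumr; apply: eq_bigr => k _.
  by rewrite !scalerA mulrC.
have WE u : u_domain u -> (W \o @z_of_u K n) u = (W \o @poly_z_of_u K n) u.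
  by move=> uD /=; rewrite z_of_uE.
(* The equivalence is first proved with the polynomial inverse, which is differentiable everywhere,
   and then transferred to [z_of_u] by agreement on the open set [u_domain]. *)
apply: iff_trans.
  apply: (@solves_system_change_var _ _ _ _ (@u_domain K n) (@u_of_z K n)
    (@poly_z_of_u K n)).
  - exact: kz_domain_open.
  - by move=> z zD; exists z.
  - by move=> u /u_domainE.
  - exact: differentiable_u_of_z.
  - by move=> u _; exact: differentiable_poly_z_of_u.
  - by move=> z /set_mem /u_of_zK.
by split; apply: eq_solves_system => // *; rewrite ?HE ?WE//;
  exact: u_domain_open.
Qed.
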